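(* Let $(p_i)_{i\geq1}$ be a strictly decreasing Kakeya sequence. (1) If there exists an integer $N\geq1$ such that $$\sum_{i=0}^\infty p_{n+2i}<p_{n-1}\qquad\text{for all } n\geq N,$$ then the sequence $0^N(10)^\infty$ (i.e. $N$ zeros followed by the periodic sequence $1,0,1,0,\dots$) is the unique expansion with respect to $(p_i)$ of the number it represents. (2) Assume moreover that $p_n\leq 2p_{n+1}$ for all sufficiently large $n$. If some $x\in(0,\sum_{i=1}^\infty p_i)$ has a unique expansion with respect to $(p_i)$, then $$\sum_{i=n+1}^\infty p_i\leq p_{n-1}\quad\text{for all sufficiently large } n,$$ and $$\sum_{i=n+1}^\infty p_i<p_{n-1}\quad\text{for infinitely many } n.$$
   Context: A Kakeya sequence is a sequence $(p_i)_{i\geq1}$ of positive real numbers with $p_i\to0$ and $p_n\leq\sum_{i=n+1}^\infty p_i$ for all $n\geq1$. An expansion of $x$ with respect to $(p_i)$ is a sequence $(c_i)\in\{0,1\}^{\mathbb N}$ with $x=\sum_{i=1}^\infty c_ip_i$; it is unique if $x$ has no other expansion. *)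

(* Defs.v *)
From HB Require Import structures.
From mathcomp Require Import all_boot all_order all_algebra.
From mathcomp Require Import all_classical all_reals all_analysis.

Set Implicit Arguments.
Unset Strict Implicit.
Unset Printing Implicit Defensive.

Import Order.TTheory GRing.Theory Num.Theory.
Import numFieldNormedType.Exports.

Local Open Scope classical_set_scope.
Local Open Scope ring_scope.

(* Sequences are indexed from 1: the value at index 0 of [p : R^nat] and of
   a digit sequence [c : nat -> bool] never matters.  Series of nonnegative
   terms are taken in [\bar R], so a divergent one has sum [+oo]; in
   particular the total sum of a Kakeya sequence may be infinite. *)

Definition kakeya (R : realType) (p : R^nat) : Prop :=
  [/\ forall n, (1 <= n)%N -> 0 < p n,
      p i @[i --> \oo] --> 0 &
      forall n, (1 <= n)%N ->
        ((p n)%:E <= \sum_(n.+1 <= i <oo) (p i)%:E)%E].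

Definition strictly_decreasing (R : realType) (p : R^nat) : Prop :=
  forall m n, (1 <= m)%N -> (m < n)%N -> p n < p m.

Definition expansion (R : realType) (p : R^nat) (c : nat -> bool) (x : R) :
    Prop :=
  (\sum_(1 <= i <oo) ((c i)%:R * p i)%:E = x%:E)%E.

Definition unique_expansion (R : realType) (p : R^nat) (c : nat -> bool)
    (x : R) : Prop :=
  expansion p c x /\
  forall d : nat -> bool, expansion p d x ->
    forall i, (1 <= i)%N -> d i = c i.

(* 0^N (10)^oo: zeros at 1, ..., N, then ones exactly at N+1, N+3, ... *)
Definition zeros_then_10 (N : nat) : nat -> bool :=
  fun i => (N < i)%N && odd (i - N).

(* Main.v *)
(** An expansion is unique iff, for every [n >= 1], the digits after position
    [n] that differ from [c_n] carry total weight less than [p_n].  The "if"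
    part compares two expansions at their first differing digit.  For "only
    if", suppose that this weight is at least [p_n]; then what remains after
    flipping [c_n] lies between 0 and [r_n = sum_(i > n) p_i], so the greedy
    algorithm expands it using the indices after [n].  For [0^N (10)^oo] the
    weight is [p_(n+1) + p_(n+3) + ...] when [n >= N].

    For (2), let [E_n] be the weight of the digits after [n] that agree with
    [c_n].  If [c_(n+1) <> c_n], or if [E_n < p_n], then
    [p_(n+1) + E_(n+1) < p_n].  As [p_n <= 2 p_(n+1)], this gives
    [E_(n+1) < p_(n+1)], and the inequality propagates from any sufficiently
    late change of digit.  Adding the weight of the differing digits gives
    [r_(n+1) < p_n] for all large [n]. *)

Require Import Defs.
From HB Require Import structures.
From mathcomp Require Import all_boot all_order all_algebra.
From mathcomp Require Import all_classical all_reals all_analysis.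
From mathcomp Require Import lra zify.

Import Order.TTheory GRing.Theory Num.Theory.
Import numFieldNormedType.Exports.

Local Open Scope classical_set_scope.
Local Open Scope ring_scope.

(** * Tails of nonnegative series, valued in the extended reals *)

Definition tail {R : realType} (f : R^nat) (n : nat) : \bar R :=
  (\sum_(n.+1 <= i <oo) (f i)%:E)%E.

(** Matches the summand of [expansion], so that [expansion p c x] is convertible to
    [tail (select c p) 0 = x%:E]. *)
Definition select {R : realType} (c : nat -> bool) (p : R^nat) : R^nat :=
  fun i => (c i)%:R * p i.

Lemma eq_tail (R : realType) (f g : R^nat) (n : nat) :
  (forall i, (n < i)%N -> f i = g i) -> tail f n = tail g n.
Proof.
move=> fg; apply/congr_lim/funext => m.
by apply: eq_big_nat => i /andP[ni _]; rewrite fg.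
Qed.

Lemma tail_ge_partial (R : realType) (f : R^nat) (n m : nat) :
  (forall i, (n < i)%N -> 0 <= f i) ->
  ((\sum_(n.+1 <= i < m) f i)%:E <= tail f n)%E.
Proof.
move=> f0; rewrite -sumEFin; apply: nneseries_lim_ge => i ni _.
by rewrite lee_fin f0.
Qed.

Lemma tail_le (R : realType) (f : R^nat) (n : nat) (y : \bar R) :
  (forall i, (n < i)%N -> 0 <= f i) ->
  (forall m, (n < m)%N -> ((\sum_(n.+1 <= i < m.+1) f i)%:E <= y)%E) ->
  (tail f n <= y)%E.
Proof.
move=> f0 fy; apply: lime_le.
  by apply: is_cvg_nneseries => i ni _; rewrite lee_fin f0.
exists n.+2 => // -[|m] //= nm; rewrite sumEFin; exact: fy.
Qed.

Lemma tail_ge0 (R : realType) (f : R^nat) (n : nat) :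
  (forall i, (n < i)%N -> 0 <= f i) -> (0 <= tail f n)%E.
Proof. by move=> f0; apply: nneseries_ge0 => i ni _; rewrite lee_fin f0. Qed.

Lemma le_tail (R : realType) (f g : R^nat) (n : nat) :
  (forall i, (n < i)%N -> 0 <= f i) -> (forall i, (n < i)%N -> f i <= g i) ->
  (tail f n <= tail g n)%E.
Proof.
move=> f0 fg; apply: tail_le => // m nm.
apply: (@le_trans _ _ (\sum_(n.+1 <= i < m.+1) g i)%:E).
  by rewrite lee_fin; apply: ler_sum_nat => i /andP[ni _]; exact: fg.
by apply: tail_ge_partial => i ni; exact: le_trans (f0 _ ni) (fg _ ni).
Qed.

Lemma tail_split (R : realType) (f : R^nat) (n k : nat) :
  (forall i, (n < i)%N -> 0 <= f i) ->
  tail f n = ((\sum_(n.+1 <= i < (n + k).+1) f i)%:E + tail f (n + k))%E.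
Proof.
move=> f0; rewrite /tail (@nneseries_split _ _ n.+1 k); last first.
  by move=> i ni; rewrite lee_fin f0.
by rewrite addSn sumEFin.
Qed.

Lemma tailS (R : realType) (f : R^nat) (n : nat) :
  (forall i, (n < i)%N -> 0 <= f i) ->
  tail f n = ((f n.+1)%:E + tail f n.+1)%E.
Proof. by move=> f0; rewrite (tail_split _ _ _ 1%N)// addn1 big_nat1. Qed.

(** * Subseries selected by a digit sequence *)

Section Selection.
Context {R : realType} {p : R^nat}.
Hypothesis p_ge0 : forall i, (0 < i)%N -> 0 <= p i.
Implicit Types (c d : nat -> bool) (n : nat).

Lemma select_ge0 c n i : (n < i)%N -> 0 <= select c p i.
Proof. by move=> ni; rewrite mulr_ge0// p_ge0//; case: i ni. Qed.

Lemma tail_select_ge0 c n : (0 <= tail (select c p) n)%E.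
Proof. exact/tail_ge0/select_ge0. Qed.

Lemma tail_selectS c n :
  tail (select c p) n = (((c n.+1)%:R * p n.+1)%:E + tail (select c p) n.+1)%E.
Proof. exact/tailS/select_ge0. Qed.

Lemma tail_select_le c n : (tail (select c p) n <= tail p n)%E.
Proof.
apply: le_tail => i ni; first exact: select_ge0 ni.
rewrite /select; case: (c i); rewrite ?mul1r// mul0r p_ge0//.
by case: i ni.
Qed.

Lemma tail_selectC c n :
  tail p n = (tail (select c p) n + tail (select (fun i => ~~ c i) p) n)%E.
Proof.
rewrite /tail -nneseriesD => [|i ni _|i ni _]; last 2 first.
- by rewrite lee_fin (select_ge0 _ n).
- by rewrite lee_fin (select_ge0 _ n).
apply: eq_eseriesr => i _; rewrite -EFinD /select.
by case: (c i); rewrite mul1r mul0r ?addr0 ?add0r.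
Qed.

Lemma eq_tail_select c d n :
  (forall i, (n < i)%N -> c i = d i) ->
  tail (select c p) n = tail (select d p) n.
Proof. by move=> cd; apply: eq_tail => i ni; rewrite /select cd. Qed.

(** [tail p n] may be [+oo], but a tail of an expansion is bounded by the real [x]; this permits
    cancellation in [\bar R]. *)
Lemma tail_select_fin c n (x : R) :
  expansion p c x -> tail (select c p) n \is a fin_num.
Proof.
move=> cx; rewrite ge0_fin_numE ?tail_select_ge0//.
apply: (@le_lt_trans _ _ x%:E); last by rewrite ltry.
rewrite -cx -/(select c p) -/(tail (select c p) 0).
rewrite (tail_split _ _ 0 n); last exact: select_ge0.
rewrite leeDr// lee_fin big_nat sumr_ge0// => i /andP[i0 _].
exact: select_ge0 i0.
Qed.

End Selection.

(** * Greedy expansions, and what uniqueness forces *)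

Section KakeyaExpansions.
Context {R : realType} {p : R^nat}.
Hypothesis kp : kakeya p.

Lemma kakeya_ge0 i : (0 < i)%N -> 0 <= p i.
Proof. by case: kp => p0 _ _ i0; exact/ltW/p0. Qed.

(** State of the greedy algorithm using only the indices after [n]: nothing is subtracted up to [n],
    so the recursion can start at 0. *)
Fixpoint remainder (n : nat) (y : R) (k : nat) : R :=
  if k is k'.+1 then
    let r := remainder n y k' in
    r - ((n < k)%N && (p k <= r))%:R * p k
  else y.

Definition greedy (n : nat) (y : R) (k : nat) : bool :=
  (n < k)%N && (p k <= remainder n y k.-1).

Lemma remainderS n y k :
  remainder n y k.+1 = remainder n y k - select (greedy n y) p k.+1.
Proof. by []. Qed.

Lemma remainder_head n y k : (k <= n)%N -> remainder n y k = y.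
Proof.
elim: k => // k IH kn; rewrite remainderS IH ?(ltnW kn)//.
by rewrite /select /greedy ltnNge kn mul0r subr0.
Qed.

Lemma sum_greedy n y m k : (n <= m)%N -> (m <= k)%N ->
  \sum_(m.+1 <= i < k.+1) select (greedy n y) p i =
  remainder n y m - remainder n y k.
Proof.
move=> nm; elim: k => [|k IH].
  by rewrite leqn0 => /eqP ->; rewrite big_geq// subrr.
rewrite leq_eqVlt => /predU1P[->|]; first by rewrite big_geq// subrr.
rewrite ltnS => mk; rewrite big_nat_recr// IH// remainderS.
by rewrite opprB addrCA addrC.
Qed.

Lemma remainder_ge0 n y k : 0 <= y -> 0 <= remainder n y k.
Proof.
move=> y0; elim: k => // k IH; rewrite remainderS /select /greedy /=.
by case: andP => [[_ ?]|_]; rewrite ?mul1r ?mul0r; lra.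
Qed.

(** If digit [k.+1] is 1, both sides drop by [p k.+1]. If it is 0, the remainder is below [p k.+1],
    which the Kakeya inequality bounds by the next tail. *)
Lemma remainder_le_tail n y k : (n <= k)%N ->
  (y%:E <= tail p n)%E -> ((remainder n y k)%:E <= tail p k)%E.
Proof.
case: (kp) => _ _ pt nk yt; elim: k nk => [|k IH].
  by rewrite leqn0 => /eqP n0; rewrite n0 in yt *.
rewrite leq_eqVlt => /predU1P[<-|nk]; first by rewrite remainder_head.
rewrite remainderS /select /greedy nk /=.
case: (leP (p k.+1) (remainder n y k)) => pr.
  have := IH nk; rewrite tailS => [|i ki].
    by rewrite mul1r EFinB leeBlDl.
  by apply: kakeya_ge0; case: i ki.
rewrite mul0r subr0; apply: le_trans (pt _ _) => //.
by rewrite lee_fin ltW.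
Qed.

(* Were the remainder always at least e, the greedy digits would eventually all
   be 1, leaving tail p m <= remainder m - e, whereas remainder m <= tail p m. *)
Lemma remainder_small n y (e : R) : 0 < e -> (y%:E <= tail p n)%E ->
  exists2 k, (n <= k)%N & remainder n y k < e.
Proof.
move=> e0 yt; apply: contrapT => nsmall.
have big k : (n <= k)%N -> e <= remainder n y k.
  by move=> nk; rewrite leNgt; apply/negP => ?; apply: nsmall; exists k.
have [_ /cvgr_lt /(_ e e0)[K _ pe] _] := kp.
pose m := maxn n K.
have nm : (n <= m)%N by exact: leq_maxl.
have : ((remainder n y m)%:E <= (remainder n y m - e)%:E)%E.
  apply: (le_trans (remainder_le_tail n y m nm yt)).
  apply: tail_le => [i mi|k mk].
    by apply: kakeya_ge0; case: i mi.
  rewrite lee_fin; have -> : \sum_(m.+1 <= i < k.+1) p i =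
      \sum_(m.+1 <= i < k.+1) select (greedy n y) p i.
    apply: eq_big_nat => i /andP[mi _]; rewrite /select /greedy.
    rewrite (leq_ltn_trans nm mi) /= (_ : p i <= _) ?mul1r//.
    have Ki : (K <= i)%N by rewrite (leq_trans (leq_maxr n K))// ltnW.
    by rewrite (le_trans (ltW (pe i Ki)))// big//; lia.
  rewrite sum_greedy ?(ltnW mk)//.
  by rewrite lerD2l lerN2 big// (leq_trans nm (ltnW mk)).
by rewrite lee_fin; lra.
Qed.

(** Greedy partial sums equal [y] minus the remainder, which is nonnegative and takes arbitrarily
    small values. *)
Lemma kakeya_expansion n y : 0 <= y -> (y%:E <= tail p n)%E ->
  exists d, tail (select d p) n = y%:E.
Proof.
move=> y0 yt; exists (greedy n y).
have sg0 i : (n < i)%N -> 0 <= select (greedy n y) p i.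
  exact/select_ge0/kakeya_ge0.
apply/eqP; rewrite eq_le; apply/andP; split.
  apply: tail_le => // m nm; rewrite sum_greedy ?(ltnW nm)//.
  by rewrite remainder_head// lee_fin gerBl remainder_ge0.
apply/lee_addgt0Pr => e e0; have [k nk rke] := remainder_small n y e e0 yt.
have := tail_ge_partial _ _ n k.+1 sg0; rewrite sum_greedy// remainder_head//.
move=> /(leeD2r e%:E); apply: le_trans.
by rewrite -EFinD lee_fin; lra.
Qed.

(** Splicing [c] up to [n] with [d] afterwards gives another expansion of [x]. *)
Lemma unique_expansion_tail c x n d : unique_expansion p c x ->
  tail (select d p) n = tail (select c p) n ->
  forall i, (n < i)%N -> d i = c i.
Proof.
move=> [cx uniq] dc i ni; pose e j := if (j <= n)%N then c j else d j.
have ei : e i = d i by rewrite /e leqNgt ni.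
rewrite -ei; apply: uniq; last by case: i ni {ei}.
rewrite /expansion -cx -!/(select _ p) -!/(tail (select _ p) 0).
rewrite !(tail_split _ _ 0 n); try exact/select_ge0/kakeya_ge0.
rewrite add0n; congr (_%:E + _)%E.
  by apply: eq_big_nat => j /andP[_ jn]; rewrite /select /e -ltnS jn.
by rewrite -dc; apply: eq_tail_select => j nj; rewrite /e leqNgt nj.
Qed.

Lemma unique_expansion_lt c x n : unique_expansion p c x -> (0 < n)%N ->
  (tail (select (fun i => c i != c n) p) n < (p n)%:E)%E.
Proof.
move=> cx; case: n => // n _; rewrite ltNge; apply/negP => pn.
have p0 := kakeya_ge0.
have pn0 : 0 <= p n.+1 by exact: p0.
(* If [y] is what remains after flipping digit [n.+1], an expansion of [y] by later indices yields a
   sequence with the same tail sum but another digit at [n.+1]. *)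
have flip y : 0 <= y -> (y%:E <= tail p n.+1)%E ->
  tail (select c p) n = (((~~ c n.+1)%:R * p n.+1 + y)%:E)%E -> False.
  move=> y0 /(kakeya_expansion _ _ y0)[d dy] cn.
  pose e i := if (i <= n.+1)%N then ~~ c n.+1 else d i.
  have := unique_expansion_tail c x n e cx.
  rewrite (tail_selectS p0) (_ : tail (select e p) n.+1 = y%:E); last first.
    by rewrite -dy; apply: eq_tail_select => i ni; rewrite /e leqNgt ni.
  rewrite cn -EFinD {1}/e leqnn => /(_ erefl n.+1 (leqnn _)).
  by rewrite /e leqnn; case: (c _).
have := tail_selectS p0 c n; have := tail_select_fin p0 c n.+1 x (proj1 cx).
have := tail_select_le p0 c n.+1; have := tail_selectC p0 c n.+1.
have := tail_select_ge0 p0 c n.+1; move: pn flip.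
(* With [a] the tail of [c] after [n.+1], flipping 1 to 0 leaves [p n.+1 + a], and flipping 0 to 1
   leaves [a - p n.+1]. By [pn], the first is at most the full tail and the second is
   nonnegative. *)
case: (c n.+1) => /= pn flip.
  have -> : tail (select (fun i => ~~ c i) p) n.+1 =
      tail (select (fun i => c i != true) p) n.+1.
    by apply: eq_tail_select => i _; case: (c i).
  case: (tail (select c p) n.+1) flip => // a flip a0 ac _ _ cn.
  apply: (flip (p n.+1 + a)).
  - by rewrite addr_ge0.
  - by rewrite ac addrC EFinD leeD2lE.
  - by rewrite cn -EFinD mul0r mul1r add0r.
rewrite (eq_tail_select _ c) in pn; last by move=> i _; case: (c i).
case: (tail (select c p) n.+1) pn flip => // a; rewrite lee_fin.
move=> pn flip _ _ at_ _ cn.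
apply: (flip (a - p n.+1)).
- by rewrite subr_ge0.
- by apply: le_trans at_; rewrite lee_fin gerBl.
- by rewrite cn -EFinD; congr _%:E; lra.
Qed.

End KakeyaExpansions.

(** * The converse criterion for uniqueness *)

Lemma lt_unique_expansion (R : realType) (p : R^nat) c x :
  (forall i, (0 < i)%N -> 0 <= p i) -> expansion p c x ->
  (forall n, (0 < n)%N ->
    (tail (select (fun i => c i != c n) p) n < (p n)%:E)%E) ->
  unique_expansion p c x.
Proof.
move=> p0 cx clt; split=> // d dx i i0; apply: contrapT => /eqP dci.
have : exists n, (0 < n)%N && (d n != c n) by exists i; rewrite i0.
move=> /ex_minnP[[//|n] /= dcn nmin].
have dc j : (0 < j)%N -> (j <= n)%N -> d j = c j.
  move=> j0 jn; apply: contrapT => /eqP dcj.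
  by have := nmin j; rewrite j0 dcj => /(_ isT); rewrite leqNgt ltnS jn.
have tdc : tail (select d p) n = tail (select c p) n.
  have : tail (select d p) 0 = tail (select c p) 0.
    exact: etrans dx (esym cx).
  rewrite !(tail_split _ _ 0 n); try exact: select_ge0.
  rewrite add0n (eq_big_nat _ _ (F2 := select c p)); last first.
    by move=> j /andP[j0 jn]; rewrite /select dc.
  by move=> /eqP; rewrite eq_le !leeD2lE// -eq_le => /eqP.
have := clt n.+1 isT; apply/negP; rewrite -leNgt.
move: tdc; rewrite [in RHS](tail_selectS p0) [in LHS](tail_selectS p0).
have := tail_select_fin p0 c n.+1 x cx; have := tail_select_fin p0 d n.+1 x dx.
have := tail_select_ge0 p0 d n.+1; have := tail_select_le p0 d n.+1.
have := tail_selectC p0 c n.+1.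
(* At the first difference, if [c] has 1 and [d] has 0, the tail of [d] is [p n.+1] plus that of
   [c], so the zeros of [c] weigh at least [p n.+1]. In the other case the ones of [c] do. *)
case: (c n.+1) dcn => /=; case: (d n.+1) => // _.
  have -> : tail (select (fun i => ~~ c i) p) n.+1 =
      tail (select (fun i => c i != true) p) n.+1.
    by apply: eq_tail_select => j _; case: (c j).
  move=> -> + _ _ cf; rewrite mul0r mul1r add0e => dt dE; move: dt.
  by rewrite dE addeC leeD2lE.
move=> _ _ d0 _ _; rewrite mul1r mul0r add0e => dc1.
rewrite (eq_tail_select _ c) => [|j _]; last by case: (c j).
by rewrite -dc1 leeDl.
Qed.

(** * Tail estimates forced by a unique expansion *)

Section UniqueExpansionTails.
Context {R : realType} {p : R^nat} {c : nat -> bool} {x : R}.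
Hypotheses (kp : kakeya p) (cx : unique_expansion p c x).

(* A digit a_n followed only by the opposite digit contradicts
   [unique_expansion_lt], as the full tail at n is at least p_n. *)
Lemma digits_constant_from_start M :
  (forall n, (M < n)%N -> c n.+1 = c n) -> forall n, (0 < n)%N -> c n.+1 = c n.
Proof.
elim: M => // M IH cM; apply: IH => n Mn; apply: contrapT => /eqP cn.
have n0 : (0 < n)%N by case: n Mn {cn}.
have cni i : (n < i)%N -> c i = c n.+1.
  elim: i => // i IHi; rewrite ltnS leq_eqVlt => /predU1P[->//|ni].
  by rewrite cM ?IHi// (leq_ltn_trans Mn ni).
have := unique_expansion_lt kp c x n cx n0; apply/negP; rewrite -leNgt.
rewrite (eq_tail _ _ p) => [|i ni]; first by case: kp => _ _; exact.
by rewrite /select cni// cn mul1r.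
Qed.

(** Otherwise the digits are constant from index 1 on, and [x] is 0 or the total sum. *)
Lemma digit_change M : 0 < x -> (x%:E < tail p 0)%E ->
  exists n, [/\ (M <= n)%N, (0 < n)%N & c n.+1 != c n].
Proof.
move=> x0 xS; apply: contrapT => nochange.
have /digits_constant_from_start cst n : (M < n)%N -> c n.+1 = c n.
  move=> Mn; apply: contrapT => /eqP cn; apply: nochange; exists n.
  by rewrite (ltnW Mn) cn (leq_ltn_trans _ Mn).
have c1 i : (0 < i)%N -> c i = c 1%N.
  by elim: i => // -[//|i] IH _; rewrite cst// IH.
have : tail (select c p) 0 = x%:E by exact: cx.1.
case c1E : (c 1%N) => cxE.
  move: xS; rewrite -cxE (eq_tail _ _ p) ?ltxx// => i i0.
  by rewrite /select c1// c1E mul1r.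
move: x0; suff -> : x = 0 by rewrite ltxx.
apply: EFin_inj; rewrite -cxE; apply: eseries0 => i i0 _.
by rewrite /select c1// c1E mul0r.
Qed.

Let agreeing n := tail (select (fun i => c i == c n) p) n.

Lemma tail_differing_agreeing n :
  tail p n = (tail (select (fun i => c i != c n) p) n + agreeing n)%E.
Proof.
rewrite (tail_selectC (kakeya_ge0 kp) (fun i => c i != c n)); congr (_ + _)%E.
by apply: eq_tail_select => i _; rewrite negbK.
Qed.

(** If [c n.+1 = c n], the left side is [agreeing n]. Otherwise it is the weight of the digits after
    [n] that differ from [c n], bounded by uniqueness. *)
Lemma agreeing_step n : (0 < n)%N ->
  c n.+1 != c n \/ (agreeing n < (p n)%:E)%E ->
  ((p n.+1)%:E + agreeing n.+1 < (p n)%:E)%E.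
Proof.
move=> n0; have := unique_expansion_lt kp c x n cx n0; rewrite /agreeing.
rewrite [X in (X < _)%E -> _](tail_selectS (kakeya_ge0 kp)).
rewrite (tail_selectS (kakeya_ge0 kp) _ n) => + H.
case: (eqVneq (c n.+1) (c n)) H => [cn [//|]|cn _].
  by rewrite mul1r => + _; under [select _ p]eq_fun do rewrite -cn.
rewrite mul1r (@eq_tail_select _ p _ (fun i => c i == c n.+1)) // => i _.
by move: cn; case: (c i); case: (c n); case: (c n.+1).
Qed.

Lemma agreeing_lt n m : (0 < n)%N -> (n < m)%N -> c n.+1 != c n ->
  (forall k, (n <= k)%N -> p k <= 2 * p k.+1) ->
  (agreeing m < (p m)%:E)%E.
Proof.
move=> n0 nm cn p2; elim: m nm => // m IH; rewrite ltnS leq_eqVlt => nm.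
have m0 : (0 < m)%N by case/orP: nm => [/eqP <-//|]; exact: leq_ltn_trans.
have : ((p m.+1)%:E + agreeing m.+1 < (p m)%:E)%E.
  apply: agreeing_step => //; case/predU1P: nm => [<-|/IH]; first by left.
  by right.
have {}nm : (n <= m)%N by rewrite leq_eqVlt.
have := p2 m nm; have : (0 <= agreeing m.+1)%E.
  exact/tail_select_ge0/kakeya_ge0.
by case: (agreeing m.+1) => // a _ ?; rewrite -EFinD !lte_fin; lra.
Qed.

Lemma tail_lt_prev n m : (0 < n)%N -> (n < m)%N -> c n.+1 != c n ->
  (forall k, (n <= k)%N -> p k <= 2 * p k.+1) ->
  (tail p m.+1 < (p m)%:E)%E.
Proof.
move=> n0 nm cn p2; have m0 := leq_ltn_trans (leq0n n) nm.
have := agreeing_step m m0 (or_intror (agreeing_lt n m n0 nm cn p2)).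
have := unique_expansion_lt kp c x m.+1 cx isT.
rewrite tail_differing_agreeing.
(* The two upper bounds exclude [+oo]; adding them cancels [p m.+1]. *)
case: (tail _ _) => [a||]; case: (agreeing _) => [b||]; rewrite ?ltNyr//.
by rewrite -!EFinD !lte_fin; lra.
Qed.

End UniqueExpansionTails.

(** * The sequence [0^N (10)^oo] *)

Lemma tail_odd_le (R : realType) (p : R^nat) n :
  (forall i, (0 < i)%N -> 0 <= p i) ->
  (tail (select (fun i => odd (i - n)) p) n <=
   \sum_(0 <= i <oo) (p (n.+1 + 2 * i)%N)%:E)%E.
Proof.
move=> p0; apply: tail_le => [|m nm]; first exact: select_ge0.
have partial k : \sum_(n.+1 <= i < (n + 2 * k).+1)
    select (fun i => odd (i - n)) p i = \sum_(0 <= i < k) p (n.+1 + 2 * i)%N.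
  elim: k => [|k IH]; first by rewrite muln0 addn0 !big_geq.
  rewrite (_ : (n + 2 * k.+1)%N = (n + 2 * k).+2); last lia.
  rewrite [RHS]big_nat_recr// -IH 2?big_nat_recr/=; try lia.
  rewrite /select (_ : odd ((n + 2 * k).+1 - n)); last lia.
  rewrite (_ : odd ((n + 2 * k).+2 - n) = false); last lia.
  by rewrite mul1r mul0r addr0 addSn.
(* The partial sum up to index [m] is enlarged to [m] whole pairs, ending at [n + 2 * m]. *)
apply: (@le_trans _ _ (\sum_(0 <= i < m) p (n.+1 + 2 * i)%N)%:E).
  rewrite -partial lee_fin.
  rewrite (@big_cat_nat _ _ _ m.+1 _ (n + 2 * m).+1)//=; try lia.
  by rewrite lerDl big_nat sumr_ge0// => i /andP[i0 _]; exact: select_ge0 i0.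
rewrite -sumEFin; apply: nneseries_lim_ge => i _ _.
by rewrite lee_fin p0.
Qed.

(** The condition [2 <= n] keeps the arbitrary value [p 0] out of the hypothesis. *)
Lemma unique_zeros_then_10 (R : realType) (p : R^nat) (N : nat) :
  kakeya p -> strictly_decreasing p -> (0 < N)%N ->
  (forall n, (N <= n)%N -> (2 <= n)%N ->
    (\sum_(0 <= i <oo) (p (n + 2 * i)%N)%:E < (p n.-1)%:E)%E) ->
  exists x, unique_expansion p (zeros_then_10 N) x.
Proof.
move=> kp dp N0 pN; have p0 := kakeya_ge0 kp.
set c := zeros_then_10 N.
have odd_lt n : (N <= n)%N ->
    (tail (select (fun i => odd (i - n)) p) n < (p n)%:E)%E.
  move=> Nn; apply: le_lt_trans (tail_odd_le _ _ _ p0) _.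
  by apply: (pN n.+1); lia.
have headE n : (n <= N)%N ->
    tail (select c p) n = tail (select (fun i => odd (i - N)) p) N.
  move=> nN; rewrite (tail_split _ _ n (N - n)) ?subnKC//; last first.
    exact: select_ge0.
  rewrite big_nat big1 ?add0e => [|i /andP[_ iN]].
    by apply: eq_tail_select => i Ni; rewrite /c /zeros_then_10 Ni.
  by rewrite /select /c /zeros_then_10 ltnNge -ltnS iN mul0r.
exists (fine (tail (select c p) 0)); apply: lt_unique_expansion => //.
  rewrite /expansion fineK// ge0_fin_numE ?tail_select_ge0//.
  by rewrite headE//; apply: lt_trans (odd_lt _ (leqnn N)) (ltry _).
(* For [n <= N] the differing digits are all the ones, of weight below [p N <= p n]. For [n > N]
   they sit at odd distance from [n]. *)
move=> n n0; case: (leqP n N) => nN.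
  rewrite (_ : c n = false); last by rewrite /c /zeros_then_10 ltnNge nN.
  rewrite (@eq_tail_select _ p _ c) => [|i _]; last by case: (c i).
  rewrite headE//; apply: lt_le_trans (odd_lt _ (leqnn N)) _; rewrite lee_fin.
  by move: nN; rewrite leq_eqVlt => /predU1P[->//|nN]; exact/ltW/dp.
rewrite (@eq_tail_select _ p _ (fun i => odd (i - n))) => [|i ni].
  exact/odd_lt/ltnW.
by rewrite /c /zeros_then_10 nN (ltn_trans nN ni) /=; lia.
Qed.

Theorem theorem2 (R : realType) (p : R^nat) :
  kakeya p -> strictly_decreasing p ->
  (forall N : nat, (1 <= N)%N ->
     (forall n : nat, (N <= n)%N -> (2 <= n)%N ->
        (\sum_(0 <= i <oo) (p (n + 2 * i)%N)%:E < (p n.-1)%:E)%E) ->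
     exists x : R, unique_expansion p (zeros_then_10 N) x)
  /\
  ((\forall n \near \oo, p n <= 2 * p n.+1) ->
   (exists x : R, [/\ 0 < x, (x%:E < \sum_(1 <= i <oo) (p i)%:E)%E &
      exists c : nat -> bool, unique_expansion p c x]) ->
   (\forall n \near \oo, (\sum_(n.+1 <= i <oo) (p i)%:E <= (p n.-1)%:E)%E)
   /\
   infinite_set [set n : nat | (\sum_(n.+1 <= i <oo) (p i)%:E < (p n.-1)%:E)%E]).
Proof.
move=> kp dp; split=> [N N0|[M _ p2] [x [x0 xS [c cx]]]].
  exact: unique_zeros_then_10.
(* The change is taken beyond [M], where the ratio bound holds at every later index. *)
have [n [Mn n0 cn]] := digit_change kp cx M x0 xS.
have lt m : (n.+1 < m)%N -> (tail p m < (p m.-1)%:E)%E.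
  case: m => // m nm; apply: (tail_lt_prev kp cx n) => // k nk.
  exact/p2/(leq_trans Mn).
split; first by exists n.+2 => // m /= nm; exact/ltW/lt.
(* The strict inequality holds on a cofinite set of indices. *)
apply: sub_infinite_set (infinite_setD infinite_nat (finite_II n.+2)).
by move=> m /= [_ /negP]; rewrite -leqNgt => /lt.
Qed.
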